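(* Let $\mathbb L(V\oplus W)$ be a simply connected minimal relative dg Lie algebra with base $\mathbb L(V)$, and let $f\colon\mathbb L(V\oplus W)\to\mathbb L(V\oplus W)$ be a quasi-isomorphism of dg Lie algebras. Suppose that $f$ restricts to an automorphism of $\mathbb L(V)$. Then $f$ is an automorphism.
   Context: All dg Lie algebras are over $\mathbb Q$ and homologically graded. $\mathbb L(V)$ denotes a quasi-free dg Lie algebra $(\mathbb L(V),d)$, i.e. one whose underlying graded Lie algebra is free on the graded vector space $V$. A dg Lie algebra $\mathfrak g$ is simply connected if $\mathfrak g=\mathfrak g_{\ge1}$. A KS-extension of a quasi-free dg Lie algebra $\mathbb L(V)$ is a quasi-free dg Lie algebra $\mathbb L(V\oplus U)$ that contains $\mathbb L(V)$ as a dg Lie subalgebra and in which $d(U)\subset Z_*(\mathbb L(V))$, where $Z_*(\mathbb L(V))$ denotes the cycles of $\mathbb L(V)$. A relative dg Lie algebra with base $\mathbb L(V)$ is a colimit $\mathcal M=\bigcup_{n\ge0}\mathcal M[n]$ of a sequence $\mathcal M[0]=\mathbb L(V)\to\mathcal M[1]=\mathbb L(V\oplus W^1)\to\mathcal M[2]=\mathbb L(V\oplus W^1\oplus W^2)\to\cdots$ of KS-extensions starting from $\mathbb L(V)$; thus $\mathcal M=\mathbb L(V\oplus W)$ with $W=\bigoplus_{i\ge1}W^i$. Let $\pi_W\colon\mathbb L(V\oplus W)\to W$ be the canonical projection. A relative dg Lie algebra $\mathbb L(V\oplus W)$ with base $\mathbb L(V)$ is called minimal if $\pi_W\circ d(W)=0$.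 *)

(* Defs.v *)
From mathcomp Require Import all_boot all_order all_algebra.
From mathcomp Require Import boolp classical_sets functions.

Set Implicit Arguments.
Unset Strict Implicit.
Unset Printing Implicit Defensive.

Import GRing.Theory.
Local Open Scope classical_set_scope.
Local Open Scope ring_scope.

Section LinearAlgebra.
Context {E : lmodType rat}.

Definition subspace (A : set E) : Prop := submod_closed (mem A).

Definition sumset (A B : set E) : set E := [set x + y | x in A & y in B].

Definition family_sum {I : eqType} (D : I -> set E) : set E :=
  [set x | exists (s : seq I) (y : I -> E),
     (forall i, D i (y i)) /\ x = \sum_(i <- s) y i].

Definition independent {I : eqType} (D : I -> set E) : Prop :=
  forall (s : seq I) (y : I -> E), uniq s -> (forall i, D i (y i)) ->
    \sum_(i <- s) y i = 0 -> forall i, i \in s -> y i = 0.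

(* Internal direct sum: S is the direct sum of the subspaces D i. *)
Definition direct_sum {I : eqType} (D : I -> set E) (S : set E) : Prop :=
  [/\ forall i, subspace (D i), S = family_sum D & independent D].

End LinearAlgebra.

Definition linear_on {E F : lmodType rat} (A : set E) (f : E -> F) : Prop :=
  forall (a : rat) x y, A x -> A y -> f (a *: x + y) = a *: f x + f y.

Definition koszul (i j : int) : rat := (-1) ^ (i * j).

(* A graded Lie algebra is given by its total space, together with the
   subspaces [gl_deg n] of homogeneous elements of degree n. *)
Record gradedLie := GradedLie {
  gl_space :> lmodType rat;
  gl_deg : int -> set gl_space;
  gl_br : gl_space -> gl_space -> gl_space;
  gl_grading : direct_sum gl_deg setT;
  gl_linl : forall y, linear (gl_br^~ y);
  gl_linr : forall x, linear (gl_br x);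
  gl_deg_br : forall i j x y,
    gl_deg i x -> gl_deg j y -> gl_deg (i + j) (gl_br x y);
  gl_antisym : forall i j x y, gl_deg i x -> gl_deg j y ->
    gl_br x y = - (koszul i j *: gl_br y x);
  gl_jacobi : forall i j x y z, gl_deg i x -> gl_deg j y ->
    gl_br x (gl_br y z) =
      gl_br (gl_br x y) z + koszul i j *: gl_br y (gl_br x z)
}.

Record dgLie := DGLie {
  dg_gl :> gradedLie;
  dg_d : dg_gl -> dg_gl;
  dg_d_linear : linear dg_d;
  dg_d_deg : forall n x, gl_deg n x -> gl_deg (n - 1) (dg_d x);
  dg_d_leibniz : forall i x y, gl_deg i x ->
    dg_d (gl_br x y) = gl_br (dg_d x) y + koszul i 1 *: gl_br x (dg_d y);
  dg_d_sq : forall x, dg_d (dg_d x) = 0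
}.

(* Subobjects are subsets of an ambient object, and maps out of a subobject A
   are maps out of the ambient object, considered on A only. *)

Section Graded.
Context {L : gradedLie}.

Definition graded_subspace (A : set L) : Prop :=
  subspace A /\ direct_sum (fun n => A `&` gl_deg n) A.

Definition lie_subalgebra (A : set L) : Prop :=
  graded_subspace A /\ (forall x y, A x -> A y -> A (gl_br x y)).

Definition graded_linear_on {H : gradedLie} (A : set L) (f : L -> H) : Prop :=
  linear_on A f /\ (forall n x, A x -> gl_deg n x -> gl_deg n (f x)).

Definition lie_hom_on {H : gradedLie} (A : set L) (f : L -> H) : Prop :=
  graded_linear_on A f /\
  (forall x y, A x -> A y -> f (gl_br x y) = gl_br (f x) (f y)).

(* The graded Lie subalgebra A is free on the graded subspace X. *)
Definition free_lie_on (X A : set L) : Prop :=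
  [/\ lie_subalgebra A, graded_subspace X, X `<=` A &
   forall (H : gradedLie) (phi : L -> H), graded_linear_on X phi ->
     exists psi : L -> H,
       [/\ lie_hom_on A psi, {in X, psi =1 phi} &
        forall psi' : L -> H, lie_hom_on A psi' -> {in X, psi' =1 phi} ->
          {in A, psi' =1 psi}]].

(* For L free on the direct sum of V and W, this is the graded Lie algebra
   morphism from L to W with zero bracket which extends the projection from
   V + W to W.  It exists and is unique by the universal property of L, so the
   default value of xget is not used. *)
Definition is_canonical_projection (V W : set L) (p : L -> L) : Prop :=
  [/\ graded_linear_on setT p, forall x y, p (gl_br x y) = 0,
      forall v, V v -> p v = 0 & forall w, W w -> p w = w].

Definition canonical_projection (V W : set L) : L -> L :=
  xget (fun=> 0) (is_canonical_projection V W).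

End Graded.

Section DG.
Context {L : dgLie}.

Definition cycles : set L := [set x | dg_d x = 0].

Definition dg_subalgebra (A : set L) : Prop :=
  lie_subalgebra A /\ (forall x, A x -> A (dg_d x)).

Definition dg_hom_on {H : dgLie} (A : set L) (f : L -> H) : Prop :=
  lie_hom_on A f /\ (forall x, A x -> f (dg_d x) = dg_d (f x)).

Definition dg_automorphism_on (A : set L) (f : L -> L) : Prop :=
  [/\ dg_hom_on A f, set_fun A A f &
   exists g : L -> L, [/\ dg_hom_on A g, set_fun A A g,
     {in A, cancel f g} & {in A, cancel g f}]].

Definition dg_automorphism (f : L -> L) : Prop := dg_automorphism_on setT f.

Definition homology_class (x : L) : set L := range (fun z => x + dg_d z).

(* H_*(L) = Z_*(L) / B_*(L), as a set of cosets. *)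
Definition homology : set (set L) := homology_class @` cycles.

Definition simply_connected : Prop :=
  forall (n : int) (x : L), gl_deg n x -> (n < 1)%R -> x = 0.

Definition quasi_free (X A : set L) : Prop :=
  dg_subalgebra A /\ free_lie_on X A.

(* B = L(V + U) is a KS-extension of A = L(V). *)
Definition KS_extension (V A U B : set L) : Prop :=
  [/\ quasi_free V A,
      graded_subspace U /\ V `&` U = [set 0],
      quasi_free (sumset V U) B,
      A `<=` B &
      forall u, U u -> (A `&` cycles) (dg_d u)].

Fixpoint stage_gens (V : set L) (Wi : nat -> set L) (n : nat) : set L :=
  if n is m.+1 then sumset (stage_gens V Wi m) (Wi m) else V.

(* L is a relative dg Lie algebra L(V + W) with base B = L(V); here [M n] is
   the n-th stage, and [Wi n] is the space of generators added in passing from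
   [M n] to [M n.+1], so that [Wi] is indexed from 0. *)
Definition relative_dgLie (V B W : set L) : Prop :=
  exists (M Wi : nat -> set L),
    [/\ quasi_free V B, M 0%N = B,
        forall n, KS_extension (stage_gens V Wi n) (M n) (Wi n) (M n.+1),
        \bigcup_n M n = setT & direct_sum Wi W].

Definition minimal (V W : set L) : Prop :=
  forall w, W w -> canonical_projection V W (dg_d w) = 0.

End DG.

Arguments cycles : clear implicits.
Arguments homology : clear implicits.
Arguments simply_connected : clear implicits.

(* The union of the classes of the f x for x in the class c: for a chain map f
   these classes all coincide, and this is H_*(f)(c). *)
Definition homology_map {L H : dgLie} (f : L -> H) (c : set L) : set H :=
  \bigcup_(x in c) homology_class (f x).

Definition quasi_isomorphism {L H : dgLie} (f : L -> H) : Prop :=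
  dg_hom_on setT f /\ set_bij (homology L) (homology H) (homology_map f).

(* Main.v *)
From HB Require Import structures.
Require Import Defs.
From mathcomp Require Import all_boot all_order all_algebra.
From mathcomp Require Import boolp classical_sets functions.
From mathcomp Require Import zify.

Import Order.TTheory GRing.Theory Num.Theory.
Local Open Scope classical_set_scope.
Local Open Scope ring_scope.

(* Induction on the degree shows that f is bijective on each L_n. Write
   L_n = V_n + W_n + [L,L]_n; by positivity [L,L]_n only involves brackets of
   elements of degree < n, where f is already bijective. By minimality every
   boundary lies in V + [L,L].

   Surjectivity: f reaches V_n by hypothesis and [L,L]_n by induction. For w in
   W_n, dw = f z for a cycle z of degree n - 1; as f z is a boundary, z = dy,
   and f y - w is a cycle, so f y - w = f c + de with de in V + [L,L].

   Injectivity: if x in L_n and f x = 0, then dx = 0 by induction, so x is a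
   boundary, x = v + b with v in V and b in [L,L]. Then f v lies both in L(V)
   and in [L,L], hence in [L(V),L(V)]; applying the inverse of f on L(V) gives
   v in [L(V),L(V)], so v = 0. Finally f is injective on [L,L]_n because, by
   freeness, the inverse of f in degrees < n is given there by a morphism of
   Lie algebras defined on all of L. *)

(** * Subspaces, their sums, and spans *)

Section Subspaces.
Context {E : lmodType rat}.
Implicit Types (A B S : set E) (x y : E).

Lemma subspaceP A :
  A 0 -> (forall a x y, A x -> A y -> A (a *: x + y)) -> subspace A.
Proof.
move=> A0 AL; split; first exact/mem_set.
by move=> a x y /set_mem Ax /set_mem Ay; apply/mem_set/AL.
Qed.

Lemma subspace_lin {A} : subspace A ->
  forall a x y, A x -> A y -> A (a *: x + y).
Proof. by case=> _ h a x y /mem_set Ax /mem_set Ay; exact/set_mem/h. Qed.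

Lemma subspace0 {A} : subspace A -> A 0.
Proof. by case=> /set_mem. Qed.

Lemma subspaceD {A} : subspace A -> forall x y, A x -> A y -> A (x + y).
Proof. by move=> sA x y Ax Ay; rewrite -[x]scale1r; apply: subspace_lin. Qed.

Lemma subspaceZ {A} : subspace A -> forall a x, A x -> A (a *: x).
Proof.
by move=> sA a x Ax; rewrite -[_ *: _]addr0; apply: subspace_lin => //;
  apply: subspace0.
Qed.

Lemma subspaceB {A} : subspace A -> forall x y, A x -> A y -> A (x - y).
Proof.
by move=> sA x y Ax Ay; rewrite -scaleN1r; apply: subspaceD => //;
  apply: subspaceZ.
Qed.

Lemma subspace_sum {A} (I : Type) (s : seq I) (P : pred I) (y : I -> E) :
  subspace A -> (forall i, P i -> A (y i)) -> A (\sum_(i <- s | P i) y i).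
Proof.
move=> sA Ay; apply: big_ind => //; first exact: subspace0.
exact: subspaceD.
Qed.

Lemma subspaceT : subspace [set: E].
Proof. exact: subspaceP. Qed.

Lemma subspace_set0 : subspace [set (0 : E)].
Proof. by apply: subspaceP => // a x y -> ->; rewrite scaler0 addr0. Qed.

Lemma subspaceI {A B} : subspace A -> subspace B -> subspace (A `&` B).
Proof.
move=> sA sB; apply: subspaceP; first by split; apply: subspace0.
by move=> a x y [? ?] [? ?]; split; apply: subspace_lin.
Qed.

Lemma subspace_sumset {A B} : subspace A -> subspace B -> subspace (sumset A B).
Proof.
move=> sA sB; apply: subspaceP.
  by exists 0; [exact: subspace0|exists 0; [exact: subspace0|rewrite addr0]].
move=> a _ _ [x1 Ax1 [y1 By1 <-]] [x2 Ax2 [y2 By2 <-]].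
exists (a *: x1 + x2); first exact: subspace_lin.
exists (a *: y1 + y2); first exact: subspace_lin.
by rewrite scalerDr !addrA; congr (_ + _); rewrite -!addrA; congr (_ + _);
  rewrite addrC.
Qed.

Lemma sumset_subl {A B} : subspace B -> A `<=` sumset A B.
Proof.
by move=> sB x Ax; exists x => //; exists 0; [exact: subspace0|rewrite addr0].
Qed.

Lemma sumset_subr {A B} : subspace A -> B `<=` sumset A B.
Proof.
by move=> sA x Bx; exists 0; [exact: subspace0|exists x => //; rewrite add0r].
Qed.

Lemma sumset_sub {A B S} : subspace S -> A `<=` S -> B `<=` S ->
  sumset A B `<=` S.
Proof. by move=> sS AS BS _ [x /AS Sx [y /BS Sy <-]]; apply: subspaceD. Qed.

Definition span (G : set E) : set E :=
  [set x | forall S, subspace S -> G `<=` S -> S x].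

Lemma subspace_span G : subspace (span G).
Proof.
apply: subspaceP=> [S sS _|a x y Gx Gy S sS GS]; first exact: subspace0.
by apply: subspace_lin => //; [apply: Gx|apply: Gy].
Qed.

Lemma sub_span G : G `<=` span G.
Proof. by move=> x Gx S _; apply. Qed.

Lemma span_sub G S : subspace S -> G `<=` S -> span G `<=` S.
Proof. by move=> sS GS x; apply. Qed.

End Subspaces.

(** * Finite decompositions along a family of subspaces *)

Section Families.
Context {E : lmodType rat} {I : eqType}.
Implicit Types (x : E) (s : seq I) (y : I -> E).

(** The terms form a total function vanishing off the support [s], so that two decompositions can be
    widened to a common support and combined pointwise. *)
Definition decomposes (D : I -> set E) x s y :=
  [/\ uniq s, forall i, D i (y i), forall i, i \notin s -> y i = 0 &
      x = \sum_(i <- s) y i].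

Context {D : I -> set E} (sD : forall i, subspace (D i)).

Lemma decomposes_widen {x s y} r : decomposes D x s y -> uniq r ->
  {subset s <= r} -> decomposes D x r y.
Proof.
case=> us dy y0 xE ur sr; split=> // [i|].
  by move=> ir; apply: y0; apply: contra ir; apply: sr.
rewrite xE [RHS](bigID [pred i | i \in s] _ y)/=.
rewrite [X in _ + X]big1 ?addr0 => [|i /y0//].
rewrite -[in RHS]big_filter; apply: perm_big; apply: uniq_perm => //.
  exact: filter_uniq.
by move=> i; rewrite mem_filter; case: (boolP (i \in s)) => [/sr ->|].
Qed.

Lemma decomposes_lin {a x x' s t y z} : decomposes D x s y ->
  decomposes D x' t z ->
  decomposes D (a *: x + x') (undup (s ++ t)) (fun i => a *: y i + z i).
Proof.
move=> xs yt; have ur := undup_uniq (s ++ t).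
have [|_ du u0 ->] := decomposes_widen _ xs ur.
  by move=> i; rewrite mem_undup mem_cat => ->.
have [|_ dv v0 ->] := decomposes_widen _ yt ur.
  by move=> i; rewrite mem_undup mem_cat orbC => ->.
split=> // [i|i ir|]; first by apply: subspace_lin.
  by rewrite u0 // v0 // scaler0 addr0.
by rewrite scaler_sumr -big_split.
Qed.

Lemma decomposes_ex x : family_sum D x -> exists y s, decomposes D x s y.
Proof.
move=> [s0 [y0 [dy0 ->]]].
(* The list given by [family_sum] may repeat an index; collapsing the repetitions multiplies each
   term by its multiplicity. *)
exists (fun i => y0 i *+ count_mem i s0), (undup s0); split=> [|i|i|].
- exact: undup_uniq.
- by rewrite -scaler_nat; apply: subspaceZ.
- by rewrite mem_undup => /count_memPn ->.
rewrite -big_undup_iterop_count; apply: eq_bigr => i _.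
by case: count => [|n] //; rewrite Monoid.iteropE.
Qed.

Lemma subspace_family_sum : subspace (family_sum D).
Proof.
apply: subspaceP.
  exists [::], (fun=> 0); rewrite big_nil; split=> // i; exact: subspace0.
move=> a x x' /decomposes_ex[y [s xs]] /decomposes_ex[z [t yt]].
have [_ dyz _ ->] := decomposes_lin (a := a) xs yt.
by eexists; eexists; split; [exact: dyz|].
Qed.

End Families.

(** * Linear maps and the subspaces they induce *)

Section LinearMaps.
Context {E F : lmodType rat}.

(** The basic definitions use bare functions. Rewriting with this equality turns such a function
    into a bundled one, to which the generic linearity lemmas apply. *)
Lemma linear_pack (f : E -> F) : linear f ->
  exists f' : {linear E -> F}, f' = f :> (E -> F).
Proof.
move=> lf; pose m := GRing.isLinear.Build rat E F _ f lf.
by exists (HB.pack_for {linear E -> F} f m).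
Qed.

Lemma subspace_preim (f : {linear E -> F}) {S : set F} :
  subspace S -> subspace (f @^-1` S).
Proof.
move=> sS; apply: subspaceP; rewrite /preimage/=.
  by rewrite linear0; apply: subspace0.
by move=> a x y Sx Sy; rewrite linearP; apply: subspace_lin.
Qed.

Lemma subspace_image (f : {linear E -> F}) (S : set E) :
  subspace S -> subspace (f @` S).
Proof.
move=> sS; apply: subspaceP.
  by exists 0; [exact: subspace0|rewrite linear0].
move=> a _ _ [x Sx <-] [y Sy <-]; exists (a *: x + y); last by rewrite linearP.
exact: subspace_lin.
Qed.

Lemma subspace_eq (f g : {linear E -> F}) : subspace [set x | f x = g x].
Proof.
by apply: subspaceP=> /= [|a x y fx fy]; rewrite ?linear0 // !linearP fx fy.
Qed.

Context {A : set E} {f : E -> F}.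
Hypotheses (sA : subspace A) (lf : linear_on A f).

Lemma linear_on0 : f 0 = 0.
Proof.
have := lf (-1) _ _ (subspace0 sA) (subspace0 sA).
by rewrite scaler0 addr0 scaleN1r addNr.
Qed.

Lemma linear_on_preim (S : set F) : subspace S ->
  subspace (A `&` f @^-1` S).
Proof.
move=> sS; apply: subspaceP; rewrite /preimage/=.
  by split; [exact: subspace0|rewrite linear_on0; apply: subspace0].
move=> a x y [Ax Sx] [Ay Sy]; split; first exact: subspace_lin.
by rewrite lf //; apply: subspace_lin.
Qed.

End LinearMaps.

(** * Homogeneous components and graded subspaces *)

Section Components.
Context {L : gradedLie}.
Implicit Types (A B : set L) (x y : L) (n m : int).

Lemma subspace_deg n : subspace (@gl_deg L n).
Proof. by case: (gl_grading L). Qed.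

Lemma decomposes_deg_lin {a x y s t} {u v : int -> L} :
  decomposes (@gl_deg L) x s u -> decomposes (@gl_deg L) y t v ->
  decomposes (@gl_deg L) (a *: x + y) (undup (s ++ t))
    (fun i => a *: u i + v i).
Proof. exact: decomposes_lin subspace_deg _ _ _ _ _ _ _. Qed.

Lemma decomposes0 {s} {y : int -> L} :
  decomposes (@gl_deg L) 0 s y -> forall i, y i = 0.
Proof.
case=> us dy y0 sy0 i; have [|/y0//] := boolP (i \in s).
by have [_ _ ind] := gl_grading L; apply: ind.
Qed.

Lemma decomposes_deg_ex x :
  exists (y : int -> L) s, decomposes (@gl_deg L) x s y.
Proof.
apply: (decomposes_ex subspace_deg).
by have [_ <- _] := gl_grading L.
Qed.

Definition hcomp n x := projT1 (cid (decomposes_deg_ex x)) n.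

(** The difference of two decompositions of [x] decomposes 0, so its terms vanish by independence of
    the degrees; the choice made in [hcomp] is therefore harmless. *)
Lemma hcompE {x s} {y : int -> L} n :
  decomposes (@gl_deg L) x s y -> hcomp n x = y n.
Proof.
rewrite /hcomp; case: cid => z [t xt] /= xs; apply/subr0_eq.
have := decomposes_deg_lin (a := -1) xs xt.
by rewrite scaleN1r addNr => /decomposes0/(_ n); rewrite scaleN1r addrC.
Qed.

Lemma hcomp_decomposes x : exists s, decomposes (@gl_deg L) x s (hcomp^~ x).
Proof.
have [y [s xs]] := decomposes_deg_ex x; exists s.
by rewrite (_ : hcomp^~ x = y) //; apply: funext => n; apply: hcompE xs.
Qed.

Lemma hcomp_deg n x : gl_deg n (hcomp n x).
Proof. by have [s []] := hcomp_decomposes x. Qed.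

Lemma hcomp_linear n : linear (hcomp n).
Proof.
move=> a x y; have [s xs] := hcomp_decomposes x.
have [t yt] := hcomp_decomposes y; exact: hcompE (decomposes_deg_lin xs yt).
Qed.

HB.instance Definition _ n :=
  GRing.isLinear.Build rat L L _ (hcomp n) (hcomp_linear n).

Lemma decomposes_deg {n x} : gl_deg n x ->
  decomposes (@gl_deg L) x [:: n] (fun i => if i == n then x else 0).
Proof.
move=> xn; split=> // [i|i|]; last by rewrite big_seq1 eqxx.
  by case: eqP => [->//|_]; apply/subspace0/subspace_deg.
by rewrite inE => /negbTE ->.
Qed.

Lemma hcomp_id {n x} : gl_deg n x -> hcomp n x = x.
Proof. by move=> /decomposes_deg /hcompE ->; rewrite eqxx. Qed.

Lemma hcomp_neq {n m x} : gl_deg n x -> m != n -> hcomp m x = 0.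
Proof. by move=> /decomposes_deg /hcompE -> /negbTE ->. Qed.

Lemma hcomp_ind (S : set L) x : subspace S -> (forall n, S (hcomp n x)) -> S x.
Proof.
have [s [_ _ _ {2}->]] := hcomp_decomposes x.
by move=> sS Sx; apply: subspace_sum.
Qed.

Lemma graded_subspaceP A : subspace A ->
  graded_subspace A <-> (forall n x, A x -> A (hcomp n x)).
Proof.
move=> sA; split=> [[_ [_ AE _]] n x|cA].
  rewrite {1}AE => -[s [y [dy ->]]]; rewrite linear_sum /=.
  apply: subspace_sum => //.
  move=> i _; have [Ayi yi] := dy i.
  have [->|ni] := eqVneq n i; first by rewrite hcomp_id.
  by rewrite (hcomp_neq yi ni); apply: subspace0.
split=> //; split=> [i||s y us dy sy0 i si].
- by apply: subspaceI => //; apply: subspace_deg.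
- apply/seteqP; split=> [x Ax|_ [s [y [dy ->]]]].
    have [s [_ _ _ xE]] := hcomp_decomposes x.
    exists s, (hcomp^~ x); split=> // i; split; first exact: cA.
    exact: hcomp_deg.
  by apply: subspace_sum => // i _; case: (dy i).
- have [_ _ ind] := gl_grading L; apply: (ind s) => // j.
  by case: (dy j).
Qed.

Lemma hcomp_graded {A} : graded_subspace A -> forall n x, A x -> A (hcomp n x).
Proof. by move=> gA; apply/graded_subspaceP => //; apply: gA.1. Qed.

Lemma graded_sumset A B : graded_subspace A -> graded_subspace B ->
  graded_subspace (sumset A B).
Proof.
move=> gA gB; have [sA sB] := (gA.1, gB.1).
apply/graded_subspaceP; first exact: subspace_sumset.
have [hA hB] := (hcomp_graded gA, hcomp_graded gB).
move=> n _ [x Ax [y By <-]]; exists (hcomp n x); first exact: hA.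
by exists (hcomp n y); [exact: hB|rewrite linearD].
Qed.

Lemma graded_subspaceT : graded_subspace [set: L].
Proof. by apply/graded_subspaceP => //; apply: subspaceT. Qed.

End Components.

(** Both sides are linear in [x], so homogeneous [x] suffice; there either both degrees match or
    both sides vanish. *)
Lemma hcomp_commute {L H : gradedLie} (T : L -> H) (k : int) : linear T ->
  (forall n x, gl_deg n x -> gl_deg (n + k) (T x)) ->
  forall n x, hcomp (n + k) (T x) = T (hcomp n x).
Proof.
move=> /linear_pack[{}T <-] dT n x.
pose S := [set x | (hcomp (n + k) \o T) x = (T \o hcomp n) x].
apply: (hcomp_ind S); first exact: subspace_eq.
rewrite /S/= => m; have [<-|nm] := eqVneq n m.
  have xn := hcomp_deg n x.
  by rewrite (hcomp_id (dT _ _ xn)) (hcomp_id xn).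
rewrite (hcomp_neq (hcomp_deg m x) nm) linear0.
by rewrite (hcomp_neq (dT _ _ (hcomp_deg m x))) // (inj_eq (addIr k)).
Qed.

(** * A subspace as a vector space in its own right *)

Section SubspaceType.
Context {E : lmodType rat} {A : set E}.

(* The unused proof argument lets the instances below be inferred. *)
Definition subspace_pred (sA : subspace A) : {pred E} := mem A.

HB.instance Definition _ (sA : subspace A) :=
  GRing.isSubmodClosed.Build rat E (subspace_pred sA)
    (GRing.submod_closed_semi (sA : submod_closed (subspace_pred sA))).

Definition subspace_type (sA : subspace A) :=
  {x : E | x \in subspace_pred sA}.

HB.instance Definition _ (sA : subspace A) :=
  SubChoice.copy (subspace_type sA) {x : E | x \in subspace_pred sA}.
HB.instance Definition _ (sA : subspace A) :=
  [SubChoice_isSubLmodule of subspace_type sA by <:].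

End SubspaceType.

(** * Subalgebras, decomposable elements and freeness *)

Section Brackets.
Context {L : gradedLie}.
Implicit Types (A B X : set L) (x y : L) (n m : int).

HB.instance Definition _ x :=
  GRing.isLinear.Build rat L L _ (gl_br x) (gl_linr x).

Definition gl_brl y x := gl_br x y.

HB.instance Definition _ y :=
  GRing.isLinear.Build rat L L _ (gl_brl y) (gl_linl y).

(** Subalgebras are subsets, while the targets in the universal property of a free Lie algebra are
    whole graded Lie algebras. This realises a subalgebra as such a target. *)
Lemma subLie_exists {A} : lie_subalgebra A ->
  exists (H : gradedLie) (i : H -> L),
    [/\ lie_hom_on setT i, injective i, range i = A &
        forall n (x : H), gl_deg n (i x) -> gl_deg n x].
Proof.
move=> [gA bA]; have sA := gA.1.
have hA := hcomp_graded gA.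
pose T := subspace_type sA; pose i : T -> L := val.
have Ai (x : T) : A (i x) by exact: set_mem (valP x).
pose mk x (Ax : A x) : T := Sub x (mem_set Ax).
have imk x (Ax : A x) : i (mk x Ax) = x by exact: SubK.
pose deg n := [set t : T | gl_deg n (i t)].
pose br (x y : T) := mk _ (bA _ _ (Ai x) (Ai y)).
have grading : direct_sum deg setT.
  split=> [n||s y us dy sy0 k ks].
  - apply: subspaceP; rewrite /deg/=; first exact: subspace0 (subspace_deg n).
    by move=> a x y; apply: subspace_lin (subspace_deg n) _ _ _.
  - apply/seteqP; split=> // x _; have [s [_ _ _ xE]] := hcomp_decomposes (i x).
    exists s, (fun n => mk _ (hA n _ (Ai x))); split=> [n|].
      by rewrite /deg/= imk; apply: hcomp_deg.
    apply: val_inj; rewrite raddf_sum/= -/(i x) {1}xE.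
    by apply: eq_bigr => n _; rewrite -[LHS](imk _ (hA n _ (Ai x))).
  - apply: val_inj; have [_ _ ind] := gl_grading L.
    apply: (ind s (i \o y)) => //; rewrite -[RHS](raddf0 (val : T -> L)) -sy0.
    by rewrite raddf_sum.
have iL a (x y : T) : i (a *: x + y) = a *: i x + i y by rewrite [LHS]linearP.
unshelve epose (H := @GradedLie T deg br grading _ _ _ _ _).
- by move=> y a u v; apply: val_inj; rewrite linearP/= gl_linl.
- by move=> y a u v; apply: val_inj; rewrite linearP/= linearP.
- by move=> k l x y; rewrite /deg/=; apply: gl_deg_br.
- move=> k l x y xk yl; apply: val_inj; rewrite raddfN /= linearZ/=.
  by rewrite scalerN; apply: gl_antisym xk yl.
- move=> k l x y z xk yl; apply: val_inj; rewrite raddfD /=.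
  exact: gl_jacobi xk yl.
exists H, i; split; last by [].
- by split=> //; split=> // a x y _ _; apply: iL.
- exact: val_inj.
- by apply/seteqP; split=> [_ [x _ <-]//|x Ax]; exists (mk x Ax).
Qed.

Definition dec A := span [set gl_br a b | a in A & b in A].

Lemma subspace_dec A : subspace (dec A).
Proof. exact: subspace_span. Qed.

Lemma dec_br A x y : A x -> A y -> dec A (gl_br x y).
Proof. by move=> Ax Ay; apply: sub_span; exists x => //; exists y. Qed.

Lemma dec_ind A (S : set L) : subspace S ->
  (forall x y, A x -> A y -> S (gl_br x y)) -> dec A `<=` S.
Proof.
by move=> sS AS; apply: span_sub => // _ [x Ax [y Ay <-]]; apply: AS.
Qed.

Lemma dec_sub {A B} : A `<=` B -> dec A `<=` dec B.
Proof.
move=> AB; apply: dec_ind; first exact: subspace_dec.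
by move=> x y /AB Bx /AB By; apply: dec_br.
Qed.

(** Expanding the two factors of a bracket into homogeneous components, one after the other, leaves
    in degree [n] only the pairs whose degrees add up to [n]. Claims about [A,A] in degree [n] thus
    reduce to homogeneous brackets. *)
Lemma hcomp_dec A n (S : set L) : graded_subspace A -> subspace S ->
    (forall i j x y, A x -> A y -> gl_deg i x -> gl_deg j y -> i + j = n ->
      S (gl_br x y)) ->
  dec A `<=` hcomp n @^-1` S.
Proof.
move=> gA sS AS; have hA := hcomp_graded gA.
have sS' := subspace_preim (hcomp n) sS.
apply: dec_ind => // x y Ax Ay.
apply: (hcomp_ind (gl_brl y @^-1` (hcomp n @^-1` S))).
  exact: subspace_preim.
move=> i; rewrite /preimage/= /gl_brl.
apply: (hcomp_ind (gl_br (hcomp i x) @^-1` (hcomp n @^-1` S))).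
  exact: subspace_preim.
move=> j; rewrite /preimage/=.
have xy := gl_deg_br (hcomp_deg i x) (hcomp_deg j y).
have [nE|nij] := eqVneq n (i + j); last first.
  by rewrite (hcomp_neq xy) //; apply: subspace0.
rewrite nE (hcomp_id xy); apply: AS (hcomp_deg i x) (hcomp_deg j y) _ => //;
  exact: hA.
Qed.

Lemma graded_dec A : graded_subspace A -> graded_subspace (dec A).
Proof.
move=> gA; apply/graded_subspaceP; first exact: subspace_dec.
move=> n; apply: (hcomp_dec A n (dec A)) => //; first exact: subspace_dec.
by move=> *; apply: dec_br.
Qed.

(** Both maps extend the restriction of [g] to the generators, and such an extension is unique on
    [A]. *)
Lemma free_lie_hom_eq {X A} {H : gradedLie} : free_lie_on X A ->
  forall g h : L -> H, lie_hom_on A g -> lie_hom_on A h ->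
  (forall x, X x -> g x = h x) -> forall x, A x -> g x = h x.
Proof.
move=> [_ [sX _] XA free] g h hg hh gh x Ax.
have [|psi [_ _ uniq]] := free H g.
  case: hg => -[gL gd] _; split=> [a u v Xu Xv|n u Xu].
    by apply: gL; exact: XA.
  by apply: gd; exact: XA.
rewrite (uniq g) ?(uniq h) //; try exact/mem_set.
by move=> u /set_mem /gh.
Qed.

(** The sum B = X + [A,A] is a subalgebra containing X, so the inclusion of X extends to a morphism
    from A to B. Composed with the inclusion of B it fixes X, hence is the identity on A, which
    forces A into B. *)
Lemma free_lie_generated {X A} : free_lie_on X A -> A `<=` sumset X (dec A).
Proof.
move=> freeA; have [[gA bA] gX XA free] := freeA.
have [sA sX] := (gA.1, gX.1); have sD := subspace_dec A.
pose B := sumset X (dec A).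
have BA : B `<=` A by apply: sumset_sub => //; apply: dec_ind.
have lB : lie_subalgebra B.
  split; first by apply: graded_sumset => //; apply: graded_dec.
  by move=> x y Bx By; apply: (sumset_subr sX); apply: dec_br; apply: BA.
have [H [i [[[iL ideg] ib] inji iB degi]]] := subLie_exists lB.
(* [phi] inverts the inclusion [i] on its range [B]; the default 0 is taken only off [B]. *)
pose phi x := xget 0 [set y | i y = x].
have phiK x : B x -> i (phi x) = x.
  rewrite -iB => -[y _ yx]; apply: (xgetPex 0 (P := [set y | i y = x])).
  by exists y.
have phiX x : X x -> i (phi x) = x by move=> Xx; apply/phiK/sumset_subl.
have [psi [[[psiL psid] psib] psiX _]] : exists psi : L -> H,
  [/\ lie_hom_on A psi, {in X, psi =1 phi} &
        forall psi' : L -> H, lie_hom_on A psi' -> {in X, psi' =1 phi} ->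
          {in A, psi' =1 psi}].
  apply: free; split=> [a x y Xx Xy|n x Xx xn].
    by apply: inji; rewrite iL // !phiX //; apply: subspace_lin.
  by apply: degi; rewrite phiX.
move=> x Ax; rewrite -/B -iB; exists (psi x) => //.
apply: (free_lie_hom_eq freeA (i \o psi) idfun) => //.
  split; first split.
  - by move=> a u v Au Av /=; rewrite psiL // iL.
  - by move=> n u Au un /=; apply: ideg => //; apply: psid.
  - by move=> u v Au Av /=; rewrite psib // ib.
by move=> u Xu /=; rewrite psiX ?phiX //; apply/mem_set.
Qed.

(** [H] is the graded space of [L] with zero bracket, and [i], [j] are the identity; they serve to
    pass between the two Lie structures. *)
Lemma abelian_exists : exists (H : gradedLie) (i : L -> H) (j : H -> L),
  [/\ cancel i j, linear i /\ linear j,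
      (forall n x, gl_deg n x -> gl_deg n (i x)) /\
      (forall n (x : H), gl_deg n x -> gl_deg n (j x)) &
      forall x y : H, gl_br x y = 0].
Proof.
unshelve epose (H := @GradedLie L (@gl_deg L) (fun _ _ => 0)
  (gl_grading L) _ _ _ _ _).
- by move=> y a u v; rewrite scaler0 addr0.
- by move=> y a u v; rewrite scaler0 addr0.
- by move=> i j *; apply: subspace0 (subspace_deg _).
- by move=> *; rewrite scaler0 oppr0.
- by move=> *; rewrite scaler0 addr0.
by exists H, idfun, idfun.
Qed.

End Brackets.

(** * Cycles and boundaries under a quasi-isomorphism; bijective morphisms *)

HB.instance Definition _ (K : dgLie) :=
  GRing.isLinear.Build rat K K _ (@dg_d K) (@dg_d_linear K).

Section Homology.
Context {L H : dgLie}.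
Implicit Types (K : dgLie).

Lemma homology_class_self {K} (x : K) : homology_class x x.
Proof. by exists 0; rewrite // linear0 addr0. Qed.

Lemma homology_classD {K} (x t : K) :
  homology_class (x + dg_d t) = homology_class x.
Proof.
apply/seteqP; split=> _ [z _ <-].
  by exists (t + z); rewrite // linearD addrA.
by exists (z - t); rewrite // linearB addrA addrAC addrK.
Qed.

Lemma homology_map_class (f : {linear L -> H}) :
  (forall x, f (dg_d x) = dg_d (f x)) ->
  forall x, homology_map f (homology_class x) = homology_class (f x).
Proof.
move=> fd x; apply/seteqP; split=> [y [_ [t _ <-]]|y fy].
  by rewrite linearD fd homology_classD.
by exists x => //; apply: homology_class_self.
Qed.

Context {f : {linear L -> H}} (qf : quasi_isomorphism f).

Let fd x : f (dg_d x) = dg_d (f x).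
Proof. by have [[_ h] _] := qf; apply: h. Qed.

Lemma quasi_iso_boundary z u : dg_d z = 0 -> f z = dg_d u ->
  exists y, z = dg_d y.
Proof.
move=> dz fz; have [_ [_ inj _]] := qf.
have : homology_class z = homology_class 0.
  apply: inj; [|  |by rewrite !homology_map_class // linear0 fz
    -[dg_d u]add0r homology_classD].
    by apply/mem_set; exists z.
  by apply/mem_set; exists 0; rewrite // /cycles/= linear0.
move=> z0; have : homology_class 0 z by rewrite -z0; apply: homology_class_self.
by move=> [y _ <-]; exists y; rewrite add0r.
Qed.

Lemma quasi_iso_cycle c : dg_d c = 0 -> exists z e, c = f z + dg_d e.
Proof.
move=> dc; have [_ [_ _ surj]] := qf.
have [|_ [z _ <-]] := surj (homology_class c); first by exists c.
rewrite homology_map_class // => fz.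
have : homology_class (f z) c by rewrite fz; apply: homology_class_self.
by move=> [e _ <-]; exists z, e.
Qed.

End Homology.

Lemma dg_automorphism_bij (L : dgLie) (f : L -> L) : dg_hom_on setT f ->
  (forall y, exists x, f x = y) -> (forall x, f x = 0 -> x = 0) ->
  dg_automorphism f.
Proof.
move=> hf surj ker; have [[[fL fdeg] fb] fd] := hf.
have [F FE] : exists F : {linear L -> L}, F = f :> (L -> L).
  by apply: linear_pack => a x y; apply: fL.
have inj : injective f.
  move=> x y fxy; apply/subr0_eq/ker.
  by rewrite -FE linearB FE fxy subrr.
have /choice[g gK] := surj.
have fK : cancel f g by move=> x; apply: inj; rewrite gK.
split=> //; exists g; split=> [||x _|y _]; rewrite ?gK ?fK //.
split; first split; first split.
- by move=> a x y _ _; apply: inj; rewrite fL ?gK.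
(* The inverse preserves degrees: [g x] equals its component of degree [n], because [f] is injective
   and commutes with taking components. *)
- move=> n x _ xn; rewrite (_ : g x = hcomp n (g x)); first exact: hcomp_deg.
  apply: inj; rewrite gK.
  have := hcomp_commute f 0 _ _ n (g x); rewrite addr0 gK => <-.
  - by rewrite hcomp_id.
  - by move=> a u v; apply: fL.
  - by move=> m u; rewrite addr0; apply: fdeg.
- by move=> x y _ _; apply: inj; rewrite fb ?gK.
- by move=> x _; apply: inj; rewrite fd ?gK.
Qed.

(** * Generators and universal property of a relative dg Lie algebra *)

Section RelativeDgLie.
Context {L : dgLie} {V LV W : set L} (M Wi : nat -> set L).
Context (LVfree : quasi_free V LV) (M0 : M 0%N = LV).
Context (KS : forall n,
  KS_extension (stage_gens V Wi n) (M n) (Wi n) (M n.+1)).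
Context (MT : \bigcup_n M n = setT) (Wsum : direct_sum Wi W).

Let G := stage_gens V Wi.
Let X := sumset V W.

Lemma stage_free n : free_lie_on (G n) (M n).
Proof.
case: n => [|n]; first by rewrite M0; case: LVfree.
by have [_ _ []] := KS n.
Qed.

Lemma stage_mono {m n} : (m <= n)%N -> M m `<=` M n.
Proof.
move=> /subnKC <-; elim: (n - m)%N => [|k IH]; first by rewrite addn0.
by rewrite addnS => x /IH Mx; have [_ _ _ sub _] := KS (m + k)%N; exact: sub.
Qed.

Lemma base_gens_graded : graded_subspace V.
Proof. by case: LVfree => _ []. Qed.

Lemma new_gens_subspace n : subspace (Wi n).
Proof. by case: Wsum. Qed.

Lemma stage_gens_subspace {A} n : subspace A -> subspace (stage_gens A Wi n).
Proof.
move=> sA; elim: n => //= n IH; apply: subspace_sumset => //.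
exact: new_gens_subspace.
Qed.

Lemma stage_gens_mono A m n : subspace A -> (m <= n)%N ->
  stage_gens A Wi m `<=` stage_gens A Wi n.
Proof.
move=> sA /subnKC <-; elim: (n - m)%N => [|k IH]; first by rewrite addn0.
rewrite addnS => x /IH; apply: sumset_subl; exact: new_gens_subspace.
Qed.

(** Started from zero, [stage_gens] gives the partial sums of the spaces [Wi], which exhaust their
    direct sum. *)
Lemma rel_gens_stage w : W w -> exists n, stage_gens [set 0] Wi n w.
Proof.
have [_ -> _] := Wsum; move=> [s [y [Wy ->]]].
elim: s => [|i s [n IH]]; first by exists 0%N; rewrite big_nil.
(* [Wi i] enters only at stage [i.+1]. *)
exists (maxn i.+1 n); rewrite big_cons; have s0 := @subspace_set0 L.
apply: subspaceD; first exact: stage_gens_subspace.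
  apply: (stage_gens_mono _ i.+1); rewrite ?leq_maxl //=.
  exact/sumset_subr/Wy/stage_gens_subspace.
by apply: (stage_gens_mono _ n); rewrite ?leq_maxr.
Qed.

Lemma rel_gens_graded : graded_subspace W.
Proof.
have [sWi WE _] := Wsum.
have sW : subspace W by rewrite WE; apply: subspace_family_sum.
apply/graded_subspaceP => // n x.
rewrite {1}WE => -[s [y [Wy ->]]]; rewrite linear_sum WE.
exists s, (fun i => hcomp n (y i)); split=> // i.
have [_ [gWi _] _ _ _] := KS i; exact: hcomp_graded.
Qed.

(** [direct_sum] separates the [Wi] only from one another; that they avoid [V] comes from the
    KS-extensions. The last summand is stripped off repeatedly: if v = u + w with w in [Wi n], then
    w = v - u lies in [G n], hence is 0. *)
Lemma gens_disjoint v : V v -> W v -> v = 0.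
Proof.
move=> Vv /rel_gens_stage[n]; elim: n => // n IH [u Gu [w Ww uw]].
have sV := base_gens_graded.1.
suff w0 : w = 0 by apply: IH; rewrite -uw w0 addr0.
have [_ [_ dis] _ _ _] := KS n.
have : (G n `&` Wi n) w; last by rewrite dis.
split=> //; rewrite (_ : w = v - u); last by rewrite -uw addrC addKr.
have sG := stage_gens_subspace n sV.
apply: subspaceB => //; first exact: (stage_gens_mono _ 0%N).
elim: (n) u Gu {uw IH sG dis} => [u ->|k IH u]; first exact: subspace0.
move=> [u1 /IH Gu1 [w1 Ww1 <-]]; exists u1 => //; exists w1 => //.
Qed.

Lemma gens_graded : graded_subspace X.
Proof. exact: graded_sumset base_gens_graded rel_gens_graded. Qed.

Lemma stage_gens_sub n : G n `<=` X.
Proof.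
elim: n => [|n IH]; first exact/sumset_subl/rel_gens_graded.1.
apply: sumset_sub => //; first exact: gens_graded.1.
move=> w Ww; apply: (sumset_subr base_gens_graded.1).
have [_ -> _] := Wsum; exists [:: n], (fun j => if j == n then w else 0).
rewrite big_seq1 eqxx; split=> // j; case: eqP => [->//|_].
exact/subspace0/new_gens_subspace.
Qed.

Lemma gens_stage x : X x -> exists n, G n x.
Proof.
move=> [v Vv [w /rel_gens_stage[n nw] <-]]; exists n.
have sV := base_gens_graded.1; have sG := stage_gens_subspace n sV.
apply: subspaceD => //; first exact: (stage_gens_mono _ 0%N).
elim: n w nw {sG} => [w ->|n IH w]; first exact: subspace0.
by move=> [u1 /IH Gu1 [w1 Ww1 <-]]; exists u1 => //; exists w1.
Qed.

Lemma rel_generated x : sumset X (dec setT) x.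
Proof.
have [n _ Mx] : (\bigcup_n M n) x by rewrite MT.
have [u Gu [y dy <-]] := free_lie_generated (stage_free n) _ Mx.
exists u; first exact: stage_gens_sub Gu.
by exists y => //; apply: dec_sub dy.
Qed.

(** Freeness is known only for the stages. The map extends over each stage, the extensions agree on
    smaller stages by uniqueness, and they glue to a map on the union; [idx] picks a stage for each
    element. *)
Lemma rel_hom_exists (H : gradedLie) (phi : L -> H) : graded_linear_on X phi ->
  exists psi : L -> H, lie_hom_on setT psi /\ forall x, X x -> psi x = phi x.
Proof.
move=> [phiL phid].
have /choice[psi psiP] n : exists psi : L -> H, lie_hom_on (M n) psi /\
    forall x, G n x -> psi x = phi x.
  have [_ _ _ free] := stage_free n.
  have [|psi [hpsi psiE _]] := free H phi.
    split=> [a x y Gx Gy|m x Gx].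
      by apply: phiL; apply: (stage_gens_sub n).
    by apply: phid; exact: stage_gens_sub Gx.
  by exists psi; split=> // x Gx; apply/psiE/mem_set.
have sV := base_gens_graded.1.
have psi_le m n x : (m <= n)%N -> M m x -> psi n x = psi m x.
  move=> mn; have [[[[nL nd] nb] nE] [hm mE]] := (psiP n, psiP m).
  have MM := stage_mono mn.
  apply: (free_lie_hom_eq (stage_free m)) => //.
    split; first split.
    - by move=> a u v Mu Mv; apply: nL; apply: MM.
    - by move=> k u Mu; apply: nd; apply: MM.
    - by move=> u v Mu Mv; apply: nb; apply: MM.
  by move=> u Gu; rewrite nE ?mE //; exact: (stage_gens_mono _ _ _ sV mn).
have /choice[idx idxP] x : exists n, M n x.
  have [n _ Mx] : (\bigcup_n M n) x by rewrite MT.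
  by exists n.
have psiE n x : M n x -> psi (idx x) x = psi n x.
  move=> Mx; have [le|le] := leqP (idx x) n.
    by rewrite (psi_le (idx x) n).
  by rewrite (psi_le n (idx x)) // ltnW.
have common x y : exists n, M n x /\ M n y.
  exists (maxn (idx x) (idx y)).
  by split; [apply: stage_mono (leq_maxl _ _) _ (idxP x)|
             apply: stage_mono (leq_maxr _ _) _ (idxP y)].
exists (fun x => psi (idx x) x); split; last first.
  move=> x /gens_stage[n Gx]; rewrite (psiE n); first by case: (psiP n) => _ ->.
  by have [_ _ GM _] := stage_free n; apply: GM.
split; first split.
- move=> a x y _ _; have [n [Mx My]] := common x y.
  have [[[sM _] _] _ _ _] := stage_free n.
  rewrite !(psiE n) //; last exact: subspace_lin.
  by have [[[nL _] _] _] := psiP n; apply: nL.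
- by move=> n x _ xn; have [[[_ d] _] _] := psiP (idx x); apply: d.
- move=> x y _ _; have [n [Mx My]] := common x y.
  have [[_ bM] _ _ _] := stage_free n.
  rewrite !(psiE n) //; last exact: bM.
  by have [[_ b] _] := psiP n; apply: b.
Qed.

(* Killing the brackets amounts to mapping into the abelian Lie algebra with
   the same underlying graded space. *)
Lemma rel_projection_exists (phi : L -> L) : graded_linear_on X phi ->
  exists q : {linear L -> L},
    [/\ forall n x, gl_deg n x -> gl_deg n (q x),
        forall x, dec setT x -> q x = 0 &
        forall x, X x -> q x = phi x].
Proof.
move=> [phiL phid].
have [H [i [j [ij [iL jL] [id jd] H0]]]] := @abelian_exists L.
have [|psi [[[psiL psid] psib] psiE]] := rel_hom_exists H (i \o phi).
  split=> [a x y Xx Xy|n x Xx xn] /=; first by rewrite phiL // iL.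
  exact/id/phid.
have [|q qE] := @linear_pack _ _ (j \o psi).
  by move=> a x y /=; rewrite psiL // jL.
exists q; rewrite qE /=; split=> [n x xn|x dx|x Xx]; first exact/jd/psid.
  rewrite -[LHS]/((j \o psi) x) -qE.
  apply: (dec_ind _ (q @^-1` [set 0])) dx.
    exact/subspace_preim/subspace_set0.
  move=> u v _ _; rewrite /preimage/= qE /= psib // H0.
  by have [j' <-] := linear_pack j jL; rewrite linear0.
by rewrite psiE //= ij.
Qed.

Lemma gens_projection_exists : exists q : {linear L -> L},
  (forall x, dec setT x -> q x = 0) /\ forall x, X x -> q x = x.
Proof.
have [|q [_ q0 qX]] := rel_projection_exists idfun; first by split.
by exists q.
Qed.

(** Write x = v + b with v in V and b in [L(V),L(V)]. The projection [q] kills both x and b and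
    fixes v, so v = 0. *)
Lemma base_dec x : LV x -> dec setT x -> dec LV x.
Proof.
have [q [q0 qX]] := gens_projection_exists.
have [_ LVf] := LVfree.
move=> /(free_lie_generated LVf)[v Vv [b db <-]] dx.
suff -> : v = 0 by rewrite add0r.
have Xv : X v by exact: (sumset_subl rel_gens_graded.1).
by rewrite -(qX v Xv) -(q0 _ dx) linearD (q0 b) ?addr0 //; exact: dec_sub db.
Qed.

Lemma base_gens_dec v : V v -> dec setT v -> v = 0.
Proof.
have [q [q0 qX]] := gens_projection_exists => Vv /q0 <-.
by rewrite qX //; exact: (sumset_subl rel_gens_graded.1).
Qed.

(** Existence is what keeps [xget] from returning its default: the projection of V + W onto W
    extends to a map killing all brackets. *)
Lemma canonical_projectionP :
  is_canonical_projection V W (canonical_projection V W).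
Proof.
apply: (xgetPex (fun=> 0) (P := is_canonical_projection V W)).
have [sV sW] := (base_gens_graded.1, rel_gens_graded.1).
(* The W-component of an element of V + W, unique since V and W meet only in 0. *)
pose phi x := xget 0 [set w | W w /\ V (x - w)].
have phiP x : X x -> W (phi x) /\ V (x - phi x).
  move=> [v Vv [w Ww <-]].
  apply: (xgetPex 0 (P := [set w' | W w' /\ V (v + w - w')])).
  by exists w; rewrite /= addrK.
have phiE x w : X x -> W w -> V (x - w) -> phi x = w.
  move=> /phiP[Wp Vp] Ww Vw; apply/subr0_eq/gens_disjoint.
    rewrite (_ : _ - _ = (x - w) - (x - phi x)); first exact: subspaceB.
    by rewrite opprB [RHS]addrC addrA subrK.
  exact: subspaceB.
have [|p [pd p0 pX]] := rel_projection_exists phi.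
  split=> [a x y Xx Xy|n x Xx xn].
    have [[Wx Vx] [Wy Vy]] := (phiP x Xx, phiP y Xy).
    apply: phiE; first exact: subspace_lin gens_graded.1 _ _ _ Xx Xy.
      exact: subspace_lin.
    rewrite opprD addrACA -scalerBr; exact: subspace_lin.
  have [Wx Vx] := phiP x Xx.
  rewrite (phiE x (hcomp n (phi x)) Xx); first exact: hcomp_deg.
    exact: hcomp_graded rel_gens_graded _ _ Wx.
  rewrite -{1}(hcomp_id xn) -linearB.
  exact: hcomp_graded base_gens_graded _ _ Vx.
exists (p : L -> L); split=> [|x y|v Vv|w Ww].
- by split=> [a x y _ _|n x _]; [rewrite linearP|apply: pd].
- exact: (p0 _ (dec_br setT _ _ I I)).
- have Xv := sumset_subl sW _ Vv; rewrite pX //; apply: phiE => //.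
    exact: subspace0.
  by rewrite subr0.
- have Xw := sumset_subr sV _ Ww; rewrite pX //; apply: phiE => //.
  by rewrite subrr; apply: subspace0.
Qed.

(** The canonical projection composed with d vanishes on V, as dV lies in L(V) and so in V + [L,L];
    on W, by minimality; and on brackets, by the Leibniz rule. Applied to a boundary v + w + b it
    returns w, so w = 0. *)
Lemma minimal_boundary : minimal V W ->
  forall x, sumset V (dec setT) (dg_d x).
Proof.
move=> minW x; have [[pL _] pb pV pW] := canonical_projectionP.
have [|p pE] := @linear_pack _ _ (canonical_projection V W).
  by move=> a u v; apply: pL.
rewrite /minimal -pE in pb pV pW minW.
have pdec : dec setT `<=` p @^-1` [set 0].
  apply: dec_ind => [|u v _ _]; last exact: pb.
  exact/subspace_preim/subspace_set0.
have sS : subspace ((p \o @dg_d L) @^-1` [set 0]).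
  exact/subspace_preim/subspace_set0.
have pd : p (dg_d x) = 0.
  have [u [v Vv [w Ww <-]] [b db <-]] := rel_generated x.
  apply: (subspaceD sS); first apply: (subspaceD sS); last 1 first.
  - apply: (dec_ind _ _ sS) db => y z _ _.
    apply: (hcomp_ind (gl_brl z @^-1` ((p \o @dg_d L) @^-1` [set 0]))).
      exact: subspace_preim.
    move=> n; rewrite /preimage/= /gl_brl (dg_d_leibniz _ (hcomp_deg n y)).
    by rewrite linearD linearZ /= !pb scaler0 addr0.
  - have [[_ dLV] LVf] := LVfree; have [_ _ VLV _] := LVf.
    have [v' Vv' [b' db' dvE]] := free_lie_generated LVf _ (dLV _ (VLV _ Vv)).
    rewrite /preimage/= -dvE linearD (pV v') // add0r.
    exact: (pdec _ (dec_sub (@subsetT _ _) _ db')).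
  - exact: minW.
have [u [v Vv [w Ww <-]] [b db dE]] := rel_generated (dg_d x).
exists v => //; exists b => //; rewrite -dE.
suff -> : w = 0 by rewrite addr0.
move: pd; rewrite -dE !linearD (pV v) // (pW w) // (pdec b) //.
by rewrite add0r addr0.
Qed.

(** * Bijectivity of the quasi-isomorphism by induction on the degree *)

Context {f : {linear L -> L}} (L_pos : simply_connected L).
Context (W_min : minimal V W) (f_qis : quasi_isomorphism f).
Context (f_base : dg_automorphism_on LV f).

Let f_deg n x : gl_deg n x -> gl_deg n (f x).
Proof. by have [[[[_ h] _] _] _] := f_qis; apply: h. Qed.

Let f_br x y : f (gl_br x y) = gl_br (f x) (f y).
Proof. by have [[[_ h] _] _] := f_qis; apply: h. Qed.

Let f_d x : f (dg_d x) = dg_d (f x).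
Proof. by have [[_ h] _] := f_qis; apply: h. Qed.

Definition bijective_below (n : int) := forall k, k < n ->
  (forall y, gl_deg k y -> exists2 x, gl_deg k x & f x = y) /\
  (forall x, gl_deg k x -> f x = 0 -> x = 0).

(** Nonzero elements have degree at least 1, so each factor of a nonzero bracket has degree strictly
    below that of the bracket. This brings [L,L] within reach of the induction. *)
Lemma br_deg_cases {i j : int} {a b : L} : gl_deg i a -> gl_deg j b ->
  gl_br a b = 0 \/ i < i + j /\ j < i + j.
Proof.
move=> ai bj; have [i1|i1] := ltP i 1.
  by left; rewrite (L_pos _ _ ai i1) -[LHS]/(gl_brl b 0) linear0.
have [j1|j1] := ltP j 1; first by left; rewrite (L_pos _ _ bj j1) linear0.
by right; lia.
Qed.

Lemma below_surjective n : bijective_below n ->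
  forall y, gl_deg n y -> exists2 x, gl_deg n x & f x = y.
Proof.
move=> bij y yn; pose S := f @` gl_deg n.
have sS : subspace S by apply/subspace_image/subspace_deg.
have Sdec : dec setT `<=` hcomp n @^-1` S.
  apply: hcomp_dec => [||i j a b _ _ ai bj ijn] //.
    exact: graded_subspaceT.
  have [->|[]] := br_deg_cases ai bj; first exact: subspace0.
  rewrite ijn => ilt jlt.
  have [a' ai' fa] := (bij i ilt).1 a ai.
  have [b' bj' fb] := (bij j jlt).1 b bj.
  exists (gl_br a' b'); last by rewrite f_br fa fb.
  by rewrite -ijn; apply: gl_deg_br.
have SV v : V v -> gl_deg n v -> S v.
  (* The preimage [g v] lies in L(V), perhaps not in V; membership in [S] asks only for its
     degree. *)
  move=> Vv vn; have [_ _ [g [[[[_ gd] _] _] _ _ gK]]] := f_base.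
  have LVv : LV v by have [_ [_ _ VLV _]] := LVfree; apply: VLV.
  by exists (g v); [apply: gd|apply/gK/mem_set].
have SW w : W w -> gl_deg n w -> S w.
  move=> Ww wn.
  have [z zn fz] := (bij (n - 1) ltac:(lia)).1 _ (dg_d_deg wn).
  have dz : dg_d z = 0.
    apply: (bij (n - 1 - 1) ltac:(lia)).2; first exact: dg_d_deg.
    by rewrite f_d fz dg_d_sq.
  have [y' zE] := quasi_iso_boundary f_qis z w dz fz.
  have [|c [e cE]] := quasi_iso_cycle f_qis (f y' - w).
    by rewrite linearB /= -f_d -zE fz subrr.
  have wE : w = f (y' - c) - dg_d e.
    by rewrite linearB -addrA -opprD -cE subKr.
  (* [y'], [c] and [e] need not be homogeneous, so the identity is read in degree [n]. *)
  rewrite -(hcomp_id wn) wE linearB /=; apply: subspaceB => //.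
    have := hcomp_commute f 0 (linearP f) _ n (y' - c); rewrite addr0 => ->.
      by exists (hcomp n (y' - c)) => //; apply: hcomp_deg.
    by move=> m u; rewrite addr0; apply: f_deg.
  have [v Vv [b db <-]] := minimal_boundary W_min e.
  rewrite linearD /=; apply: subspaceD => //; last exact: Sdec.
  apply: SV; last exact: hcomp_deg.
  exact: hcomp_graded base_gens_graded _ _ _.
have [u [v Vv [w Ww uE]] [b db yE]] := rel_generated y.
rewrite -[y](hcomp_id yn) -yE -uE !linearD /=.
apply: (subspaceD sS); last exact: Sdec.
apply: (subspaceD sS).
  apply: SV; last exact: hcomp_deg.
  exact: hcomp_graded base_gens_graded _ _ _.
apply: SW; last exact: hcomp_deg.
exact: hcomp_graded rel_gens_graded _ _ _.
Qed.

(* The truncated inverse is prescribed on the generators only: freeness extends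
   it to a morphism of Lie algebras. *)
Lemma below_inverse_exists n : bijective_below n ->
  exists psi : {linear L -> L},
    (forall x y, psi (gl_br x y) = gl_br (psi x) (psi y)) /\
    (forall k, k < n -> forall x, gl_deg k x -> psi (f x) = x).
Proof.
move=> bij.
(* [z] is concentrated in degrees below [n], and [f z] is the truncation of [x] to these degrees.
   The relation is linear and, by injectivity below [n], single-valued, so it is the graph of a
   linear map [phi]. *)
pose R x z := forall k,
  if k < n then f (hcomp k z) = hcomp k x else hcomp k z = 0.
have RL a x x' z z' : R x z -> R x' z' -> R (a *: x + x') (a *: z + z').
  move=> xz xz' k; move: (xz k) (xz' k); case: ifP => _.
    by rewrite !linearP /= => -> ->.
  by rewrite linearP /= => -> ->; rewrite scaler0 addr0.
have hcomp0P z : (forall k, hcomp k z = 0) -> z = 0.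
  by move=> z0; apply: (hcomp_ind [set 0] z subspace_set0).
have R0 z : R 0 z -> z = 0.
  move=> Rz; apply: hcomp0P => k; move: (Rz k); case: ifP => [kn|//].
  by rewrite linear0; apply: (bij k kn).2; apply: hcomp_deg.
have /choice[phi phiP] x : exists z, R x z.
  apply: (hcomp_ind [set x | exists z, R x z]).
    apply: subspaceP; first by exists 0 => k; rewrite !linear0; case: ifP.
    by move=> a u v [z Rz] [z' Rz']; exists (a *: z + z'); apply: RL.
  move=> k; have xk := hcomp_deg k x; have [kn|kn] := boolP (k < n).
    have [z zk fz] := (bij k kn).1 _ xk.
    exists z => j; have [->|jk] := eqVneq j k.
      by rewrite kn (hcomp_id zk) (hcomp_id xk).
    by rewrite (hcomp_neq zk jk) (hcomp_neq xk jk) linear0; case: ifP.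
  exists 0 => j; rewrite linear0; case: ifP => // jn.
  rewrite linear0 (hcomp_neq xk) //.
  by apply: contraNneq kn => <-.
have phiE x z : R x z -> phi x = z.
  move=> xz; apply/subr0_eq/R0; have := RL (-1) _ _ _ _ xz (phiP x).
  by rewrite !scaleN1r addNr addrC.
have phid k x : gl_deg k x -> gl_deg k (phi x).
  move=> xk; apply: (hcomp_ind (gl_deg k)); first exact: subspace_deg.
  move=> j; have [->|jk] := eqVneq j k; first exact: hcomp_deg.
  move: (phiP x j); case: ifP => [jn|_ ->]; last exact/subspace0/subspace_deg.
  rewrite (hcomp_neq xk jk) => /(bij j jn).2 -> //; last exact: hcomp_deg.
  exact/subspace0/subspace_deg.
have fphi k x : k < n -> gl_deg k x -> f (phi x) = x.
  move=> kn xk; have := phiP x k; rewrite kn (hcomp_id xk) hcomp_id //.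
  exact: phid.
have [|psi0 [[[psiL psid] psib] psiX]] := rel_hom_exists L phi.
  split=> [a x y _ _|k x _]; last exact: phid.
  by apply: phiE; apply: RL.
have [|psi psiE] := @linear_pack _ _ psi0; first by move=> a x y; apply: psiL.
rewrite -psiE in psid psib psiX; exists psi.
split=> [x y|k kn x xk]; first exact: psib.
(* Below [n], [psi] is a right inverse of [f]: on generators it is [phi], and brackets have factors
   of smaller degree. The induction starts at 0, where all lower degrees vanish. *)
have fpsi (m : nat) : forall j : int, j < m%:Z -> j < n ->
    forall y, gl_deg j y -> f (psi y) = y.
  elim: m => [|m IH] j jm jn y yj.
    by rewrite (L_pos _ _ yj) ?linear0 ?linear0 //; lia.
  pose S := [set y | (f \o psi) y = (idfun : {linear L -> L}) y].
  have sS : subspace S by apply: subspace_eq.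
  suff : S y by [].
  have [u Xu [b db yE]] := rel_generated y.
  rewrite -(hcomp_id yj) -yE linearD /=; apply: subspaceD => //.
    rewrite /S/= psiX; first by apply: (fphi j) => //; apply: hcomp_deg.
    exact: hcomp_graded gens_graded _ _ _.
  apply: (hcomp_dec setT j S) db => //; first exact: graded_subspaceT.
  move=> i1 i2 a b' _ _ ai bi ijE.
  have [->|[]] := br_deg_cases ai bi; first exact: subspace0.
  rewrite ijE => i1j i2j; rewrite /S/= psib // f_br.
  by rewrite (IH i1) ?(IH i2) //; lia.
(* Since [f] is injective in degree [k], the right inverse is also a left inverse there. *)
apply/subr0_eq/((bij k kn).2).
  apply: (subspaceB (subspace_deg k)) => //.
  exact/psid/f_deg.
rewrite linearB /= (fpsi (`|k|%N.+1) k) ?subrr //; first by lia.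
exact: f_deg.
Qed.

(** The composite of [psi] and [f] respects brackets in every degree and fixes the factors, which
    have degree below [n]; hence it fixes [L,L] in degree [n]. *)
Lemma below_dec_injective n : bijective_below n ->
  forall x, dec setT x -> gl_deg n x -> f x = 0 -> x = 0.
Proof.
move=> /below_inverse_exists[psi [psib psif]] x dx xn fx.
pose S := [set y | (psi \o f) y = (idfun : {linear L -> L}) y].
have sS : subspace S by apply: subspace_eq.
suff : S (hcomp n x) by rewrite /S (hcomp_id xn) /= fx linear0.
apply: (hcomp_dec setT n S) dx => //; first exact: graded_subspaceT.
move=> i j a b _ _ ai bj ijE.
have [->|[]] := br_deg_cases ai bj; first exact: subspace0.
by rewrite ijE => ilt jlt; rewrite /S/= f_br psib (psif i) ?(psif j).
Qed.

Lemma base_part_zero v b : V v -> dec setT b -> f (v + b) = 0 -> v = 0.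
Proof.
move=> Vv db fvb; have [_ fLV [g [[[[gL _] gb] _] gLV fK _]]] := f_base.
have LVv : LV v by have [_ [_ _ VLV _]] := LVfree; apply: VLV.
have sLV : subspace LV by have [_ [[[]]]] := LVfree.
apply: base_gens_dec => //; apply: (dec_sub (@subsetT _ LV)).
have fdec : dec setT `<=` f @^-1` dec setT.
  apply: dec_ind; first exact/subspace_preim/subspace_dec.
  by move=> x y _ _; rewrite /preimage/= f_br; apply: dec_br.
have : dec LV (f v).
  apply: base_dec; first exact: fLV.
  have -> : f v = - f b by apply/eqP; rewrite -addr_eq0 -linearD fvb.
  have dNb : dec setT (- b).
    by rewrite -scaleN1r; exact: (subspaceZ (subspace_dec _)).
  rewrite -(linearN f). exact: (fdec _ dNb).
(* [v] is [g (f v)], and [g], being a Lie morphism on L(V), maps [L(V),L(V)] into itself. *)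
rewrite -{2}(fK v); last exact/mem_set.
suff sub : dec LV `<=` LV `&` g @^-1` dec LV by move=> /sub[].
apply: dec_ind; first exact: linear_on_preim sLV gL _ (subspace_dec _).
move=> x y LVx LVy; split.
  by have [_ [[_ br] _ _ _]] := LVfree; apply: br.
by rewrite /preimage/= gb //; apply: dec_br; apply: gLV.
Qed.

Lemma below_injective n : bijective_below n ->
  forall x, gl_deg n x -> f x = 0 -> x = 0.
Proof.
move=> bij x xn fx.
have dx : dg_d x = 0.
  apply: (bij (n - 1) ltac:(lia)).2; first exact: dg_d_deg.
  by rewrite f_d fx linear0.
have [|e xE] := quasi_iso_boundary f_qis x 0 dx; first by rewrite fx linear0.
have [v Vv [b db vb]] := minimal_boundary W_min e.
have v0 : v = 0 by apply: (base_part_zero v b) => //; rewrite vb -xE.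
apply: (below_dec_injective n bij) => //.
by rewrite xE -vb v0 add0r.
Qed.

Lemma bijective_belowP (m : nat) : bijective_below m%:Z.
Proof.
elim: m => [|m IH] k km.
  have d0 (x : L) : gl_deg k x -> x = 0 by move=> xk; apply: L_pos xk _; lia.
  split=> [y /d0 ->|x /d0 //]; exists 0; rewrite ?linear0 //.
  exact/subspace0/subspace_deg.
have [/IH//|mk] := ltP k m%:Z.
have -> : k = m%:Z by lia.
by split; [apply: below_surjective|apply: below_injective].
Qed.

Lemma rel_quasi_iso_automorphism : dg_automorphism f.
Proof.
(* Any integer degree [k] lies below the natural number |k| + 1. *)
have bij k := bijective_belowP `|k|%N.+1 k ltac:(lia).
apply: dg_automorphism_bij; first by case: f_qis.
  move=> y; have : (f @` setT) y.
    apply: hcomp_ind; first exact/subspace_image/subspaceT.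
    by move=> k; have [x _ <-] := (bij k).1 _ (hcomp_deg k y); exists x.
  by move=> [x _ <-]; exists x.
move=> x fx; apply: (hcomp_ind [set 0] x subspace_set0) => k.
apply: (bij k).2; first exact: hcomp_deg.
have := hcomp_commute f 0 (linearP f) _ k x; rewrite addr0 fx linear0 => <- //.
by move=> m u; rewrite addr0; apply: f_deg.
Qed.

End RelativeDgLie.

Theorem theorem3p8 (L : dgLie) (V LV W : set L) (f : L -> L) :
  relative_dgLie V LV W ->
  minimal V W ->
  simply_connected L ->
  quasi_isomorphism f ->
  dg_automorphism_on LV f ->
  dg_automorphism f.
Proof.
move=> [M [Wi [LVfree M0 KS MT Wsum]]] W_min L_pos f_qis f_base.
have [f' f'E] : exists f' : {linear L -> L}, f' = f :> (L -> L).
  by apply: linear_pack => a x y; case: f_qis => -[[[fL _] _] _] _; apply: fL.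
rewrite -f'E in f_qis f_base *.
exact: (rel_quasi_iso_automorphism M Wi LVfree M0 KS MT Wsum
  L_pos W_min f_qis f_base).
Qed.
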